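(* The total mass of $\rho_{x_0}$ is finite for some (equivalently, every) starting point $x_0\ge 0$ if and only if $$\sum_{k=0}^{\infty}\bigl(1-F_\mu(k)\bigr)^2<\infty .$$
   Context: Let $\mu$ be a probability measure on $\mathbb{N}_0=\{0,1,2,\dots\}$ that is not a point mass, and let $F_\mu(x)=\mu([0,x])$ be its distribution function. Write $\mu(x)=\mu(\{x\})$ for real $x\ge 0$, so $\mu(x)=0$ if $x\notin\mathbb{N}_0$. Put $d=\gcd\operatorname{supp}(\mu)$ and $N=\sup\operatorname{supp}(\mu)\in(0,\infty]$. For real $x_0\ge0$ let $S(x_0)=\{kd\pm x_0: k\in\mathbb{Z}\}\cap[0,\infty)$ and $C(x_0)=S(x_0)\cap[0,N]$ (with $C(x_0)=S(x_0)$ if $N=\infty$). Define $$\rho(0)=\frac{1-\mu(0)}{2},\qquad \rho(x)=\sum_{k=1}^{\infty}\left(\frac{\mu(x)}{2}+\mu\bigl((x,x+k)\bigr)+\frac{\mu(x+k)}{2}\right)\mu(k)\quad\text{if } x>0,$$ and let $\rho_{x_0}$ be the measure on the denumerable set $C(x_0)$ given by $\rho_{x_0}(B)=\sum_{x\in B}\rho(x)$ for $B\subset C(x_0)$. *)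

(* Defs.v *)
From HB Require Import structures.
From mathcomp Require Import all_boot all_order all_algebra.
From mathcomp Require Import all_classical all_reals all_analysis.
Set Implicit Arguments.
Unset Strict Implicit.
Unset Printing Implicit Defensive.
Import Order.TTheory GRing.Theory Num.Theory.
Local Open Scope classical_set_scope.
Local Open Scope ring_scope.

Definition is_gcd (A : set nat) (d : nat) : Prop :=
  (forall k, A k -> (d %| k)%N) /\
  (forall e, (forall k, A k -> (e %| k)%N) -> (e %| d)%N).

Definition gcd_set (A : set nat) : nat := xget 0%N (is_gcd A).

Lemma gcd_setP (A : set nat) : is_gcd A (gcd_set A).
Proof.
apply: xgetPex; case: (pselect (exists2 k, A k & (0 < k)%N)) => [[k Ak k0]|nA].
- pose P e := `[< forall k, A k -> (e %| k)%N >].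
  have exP : exists e, P e by exists 1%N; apply/asboolP => j _; exact: dvd1n.
  have ubP e : P e -> (e <= k)%N by move=> /asboolP /(_ _ Ak); exact: dvdn_leq.
  case: (ex_maxnP exP ubP) => d /asboolP Pd maxd; exists d; split=> // e Pe.
  have : P (lcmn e d).
    by apply/asboolP => j Aj; rewrite dvdn_lcm Pe//= Pd.
  move=> /maxd led.
  have lcm0 : (0 < lcmn e d)%N.
    by rewrite lcmn_gt0 (dvdn_gt0 k0 (Pe _ Ak)) (dvdn_gt0 k0 (Pd _ Ak)).
  have ged := dvdn_leq lcm0 (dvdn_lcmr e d).
  suff <- : lcmn e d = d by exact: dvdn_lcml.
  by apply/eqP; rewrite eqn_leq led ged.
- exists 0%N; split=> // -[|k] // Ak.
  by exfalso; apply: nA; exists k.+1.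
Qed.

Section RhoMeasure.
Context {R : realType} (mu : probability nat R).

(* mu seen as a measure on the reals, concentrated on the natural numbers;
   in particular the mass of a non-natural real is 0. *)
Definition massR (B : set R) : \bar R := mu [set n : nat | B n%:R].

Definition atom (x : R) : \bar R := massR [set x].

Definition dist_fun (x : R) : \bar R := massR `[0, x].

Definition point_mass : Prop :=
  exists a : nat, forall A : set nat, mu A = dirac (R := R) a A.

Definition supp : set nat := [set k | (0 < mu [set k])%E].

Definition supp_gcd : nat := gcd_set supp.

Definition max_supp : \bar R :=
  ereal_sup [set (k%:R : R)%:E | k in supp].

Definition states_S (x0 : R) : set R :=
  [set x | 0 <= x /\ exists k : int,
     x = k%:~R * supp_gcd%:R + x0 \/ x = k%:~R * supp_gcd%:R - x0].

Definition states_C (x0 : R) : set R :=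
  states_S x0 `&` [set x | (x%:E <= max_supp)%E].

(* Only meaningful for 0 <= x. *)
Definition rho (x : R) : \bar R :=
  (if x == 0%R then (1 - atom 0%R) * (2^-1)%:E
   else \sum_(1 <= k <oo)
     (atom x * (2^-1)%:E + massR `](x : R), (x + k%:R)%R[
      + atom (x + k%:R)%R * (2^-1)%:E) * atom k%:R)%E.

Definition rho_measure (x0 : R) (B : set R) : \bar R :=
  \esum_(x in B `&` states_C x0) rho x.

Definition finite_total_mass (x0 : R) : Prop :=
  (rho_measure x0 (states_C x0) < +oo)%E.

End RhoMeasure.

(* Main.v *)
Require Import Defs.
From HB Require Import structures.
From mathcomp Require Import all_boot all_order all_algebra.
From mathcomp Require Import all_classical all_reals all_analysis.
From mathcomp Require Import zify ring.
Set Implicit Arguments.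
Unset Strict Implicit.
Unset Printing Implicit Defensive.
Import Order.TTheory GRing.Theory Num.Theory.
Local Open Scope classical_set_scope.
Local Open Scope ring_scope.

(** Let X and Y be independent with law mu, and let T(j) = P(X > j).  The
    measure rho is, up to rounding, made of the numbers

      c(i) = P(X - Y <= i < X),   i = 0, 1, 2, ...

    ([crossing]): the probability that the points X - Y and X lie on either
    side of the gap between i and i + 1.  Since X and Y are natural numbers, the
    value of rho at a real x > 0 only depends on the position of x with respect
    to the integers.  If i < x < i + 1 then rho(x) = c(i) ([rho_between]), and
    rho(i + 1) is the mean of c(i) and c(i + 1) ([rho_nat]); the factors 1/2 in
    rho are exactly the ones of this mean.

    Given X = n and Y = k, the number of i >= 0 with n - k <= i < n is
    min(n, k).  It is also the number of j with j < n and j < k, through the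
    substitution j = n - 1 - i.  Hence ([sum_crossing])

      sum_i c(i) = E min(X, Y) = sum_j T(j)^2,

    which is the series of the theorem as T(j) = 1 - F(j).  It remains to
    compare the mass of rho on the states reached from x0 with sum_i c(i).

    - Upper bound ([finite_total_mass_of_crossing]).  The states lie on two
      translates, by t and t' in [0, 1), of the natural numbers, and
      rho(t + i) <= c(i) + c(i - 1), with c(-1) replaced by 1.  So the total
      mass is at most twice 1 + 2 sum_i c(i).

    - Lower bound ([crossing_of_finite_total_mass]).  As mu lives on the
      multiples of d, the function c is constant on the blocks
      [j d, (j + 1) d) ([crossing_block]), so that sum_i c(i) is d times its sum
      along any residue class modulo d.  The states contain, up to the supremum
      of the support, a progression t + j d with 0 <= t < d, on which
      rho(t + j d) >= c(j d + s) / 2 where s is the integral part of t.  Beyond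
      this supremum the numbers c(j d + s) vanish ([crossing_beyond]). *)

(** * Series with nonnegative terms *)

Section Series.
Context {R : realType}.
Local Open Scope ereal_scope.

Lemma nneseries_finite (f : nat -> \bar R) (n : nat) :
    (forall i, 0 <= f i) ->
  \sum_(0 <= i <oo) (if (i < n)%N then f i else 0) = \sum_(0 <= i < n) f i.
Proof.
move=> f0; rewrite (nneseries_split 0 n); last by move=> i _; case: ifP.
rewrite add0n [X in _ + X]eseries0 ?adde0; last first.
  by move=> i ni _; rewrite ltnNge ni.
by rewrite !big_mkord; apply: eq_bigr => i _; rewrite ltn_ord.
Qed.

(** Splitting the index modulo d: convergence along every residue class passes
    to the whole series. *)
Lemma nneseries_le_residues (f : nat -> \bar R) (d : nat) :
    (0 < d)%N -> (forall i, 0 <= f i) ->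
  \sum_(0 <= i <oo) f i <=
  \sum_(0 <= r < d) \sum_(0 <= j <oo) f (j * d + r)%N.
Proof.
move=> d0 f0; rewrite -nneseries_sum//.
apply: lime_le; first exact: is_cvg_nneseries.
apply: nearW => n /=; apply: (@le_trans _ _ (\sum_(0 <= i < n * d) f i)).
  by apply: lee_sum_nneg_natr => //; rewrite leq_pmulr.
rewrite big_nat_mul.
under eq_bigr => j _.
  rewrite mulSn -{1}(add0n (j * d)%N) big_addn addnK.
  under eq_bigr => r _ do rewrite addnC.
  over.
by apply: nneseries_lim_ge => j _ _; exact: sume_ge0.
Qed.

Lemma esum_subset (T : choiceType) (A B : set T) (f : T -> \bar R) :
  A `<=` B -> (forall x, 0 <= f x) -> \esum_(x in A) f x <= \esum_(x in B) f x.
Proof.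
move=> AB f0; rewrite esum_mkcond [leRHS]esum_mkcond; apply: le_esum => x _.
by case: ifPn => [/set_mem/AB/mem_set ->//|_]; case: ifP.
Qed.

Lemma esum_setU_le (T : choiceType) (A B : set T) (f : T -> \bar R) :
    (forall x, 0 <= f x) ->
  \esum_(x in A `|` B) f x <= \esum_(x in A) f x + \esum_(x in B) f x.
Proof.
move=> f0; rewrite esum_mkcond [in leRHS]esum_mkcond.
rewrite [X in _ <= _ + X]esum_mkcond -esumD => [|x _|x _]; [|by case: ifP..].
apply: le_esum => x _; rewrite in_setU.
by do 2!case: (_ \in _); rewrite /= ?leeDl ?adde0 ?add0e.
Qed.

End Series.

(** * Probabilities on the natural numbers *)

Section NatMeasure.
Context {R : realType} (mu : probability nat R).
Local Open Scope ereal_scope.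

Lemma measure_nat_sum (A : set nat) :
  mu A = \sum_(0 <= n <oo) (if n \in A then mu [set n] else 0).
Proof.
have {1}-> : A = \bigcup_(n in A) [set n].
  by rewrite (bigcup_imset1 A id) image_id.
rewrite measure_bigcup.
- by rewrite eseries_mkcond.
- by [].
- by apply/trivIsetP => i j _ _ ij; apply/seteqP; split=> // x/= [-> /eqP];
    rewrite (negbTE ij).
Qed.

Lemma measure_pred_sum (P : pred nat) :
  mu [set n | P n] = \sum_(0 <= n <oo) (if P n then mu [set n] else 0).
Proof. by rewrite measure_nat_sum; under eq_eseriesr do rewrite mem_setE. Qed.

Lemma not_supp n : ~ supp mu n -> mu [set n] = 0.
Proof.
rewrite /supp/= => /negP; rewrite -leNgt => h.
by apply/eqP; rewrite eq_le h/=.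
Qed.

(** A set may be compared with another after discarding the points outside
    the support; this is how divisibility by the gcd enters. *)
Lemma le_measure_supp (A B : set nat) :
  (forall n, supp mu n -> A n -> B n) -> mu A <= mu B.
Proof.
move=> AB; rewrite (measure_nat_sum A) (measure_nat_sum B).
apply: lee_nneseries => [n _ _|n _]; first by case: ifP.
case: (pselect (supp mu n)) => [sn|/not_supp ->]; last by rewrite !if_same.
by case: ifPn => [/set_mem/(AB _ sn)/mem_set ->//|_]; case: ifP.
Qed.

Lemma measure_supp_eq0 (A : set nat) :
  (forall n, supp mu n -> ~ A n) -> mu A = 0.
Proof.
move=> nA; apply/eqP; rewrite eq_le measure_ge0 andbT -[leRHS](measure0 mu).
by apply: le_measure_supp => n /nA.
Qed.

Lemma supp_gcd_dvd n : supp mu n -> (supp_gcd mu %| n)%N.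
Proof. by have [+ _] := gcd_setP (supp mu); apply. Qed.

(** If the gcd is 0, then the support is contained in {0}. *)
Lemma supp_gcd_gt0 : ~ point_mass mu -> (0 < supp_gcd mu)%N.
Proof.
move=> nd; rewrite lt0n; apply/eqP => d0; apply: nd; exists 0%N => A.
have s0 n : supp mu n -> n = 0%N.
  by move/supp_gcd_dvd; rewrite d0 dvd0n => /eqP.
have le01 (B : set nat) : mu B <= 1 by exact: probability_le1.
rewrite diracE; case: (boolP (0%N \in A)) => [/set_mem A0|nA].
- apply/eqP; rewrite eq_le le01 -[leLHS](probability_setT mu)/=.
  by apply: le_measure_supp => n /s0 ->.
- by apply: measure_supp_eq0 => n /s0 -> /mem_set; rewrite (negbTE nA).
Qed.

(** * Crossing probabilities *)

Definition tail (j : nat) : \bar R := mu [set n | (j < n)%N].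

(** The probability that X - Y <= i < X for X and Y independent of law mu,
    conditioned on the value k of Y as in the definition of rho. *)
Definition crossing (i : nat) : \bar R :=
  \sum_(0 <= k <oo) mu [set n | (i < n <= i + k)%N] * mu [set k].

Lemma crossing_ge0 i : 0 <= crossing i.
Proof. by apply: nneseries_ge0 => k _ _; rewrite mule_ge0. Qed.

(** The same probability, conditioned on the value n of X: if i < n, then
    n <= i + Y means Y > n - 1 - i. *)
Lemma crossing_tail i :
  crossing i =
  \sum_(0 <= n <oo) (if (i < n)%N then mu [set n] * tail (n - i.+1) else 0).
Proof.
pose a k n := if (i < n <= i + k)%N then mu [set n] * mu [set k] else 0.
have a0 k n : 0 <= a k n by rewrite /a; case: ifP => // _; rewrite mule_ge0.
transitivity (\sum_(0 <= k <oo) \sum_(0 <= n <oo) a k n).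
  apply: eq_eseriesr => k _.
  rewrite muleC -[mu [set k]]fineK; last exact: fin_num_measure.
  rewrite (measure_pred_sum (fun n => i < n <= i + k)%N).
  rewrite -nneseriesZl => [|n _]; last by case: ifP.
  apply: eq_eseriesr => n _; rewrite /a; case: ifP => _; last by rewrite mule0.
  by rewrite muleC fineK// fin_num_measure.
rewrite nneseries_interchange//; apply: eq_eseriesr => n _.
case: ifPn => [ltin|nin]; last first.
  by apply: eseries0 => k _ _; rewrite /a (negbTE nin).
rewrite -[mu [set n]]fineK; last exact: fin_num_measure.
rewrite /tail measure_pred_sum -nneseriesZl => [|k _]; last by case: ifP.
apply: eq_eseriesr => k _; rewrite /a ltin/= fineK ?fin_num_measure//.
have -> : (n - i.+1 < k)%N = (n <= i + k)%N by lia.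
by case: ifP => // _; rewrite mule0.
Qed.

(** Both sides are E min(X, Y).  By [crossing_tail] the contribution of X = n to
    the left-hand side is T(n - 1) + ... + T(0); reversing this finite sum and
    summing over n > j first leaves T(j) as the coefficient of T(j). *)
Lemma sum_crossing :
  \sum_(0 <= i <oo) crossing i = \sum_(0 <= j <oo) tail j ^+ 2.
Proof.
have T0 j : 0 <= tail j by exact: measure_ge0.
under eq_eseriesr do rewrite crossing_tail.
rewrite nneseries_interchange; last first.
  by move=> i n; case: ifP => // _; rewrite mule_ge0.
transitivity (\sum_(0 <= n <oo) \sum_(0 <= j <oo)
    if (j < n)%N then mu [set n] * tail j else 0).
  apply: eq_eseriesr => n _.
  rewrite !nneseries_finite => [|i|i]; [|by rewrite mule_ge0..].
  (* the substitution j = n - 1 - i *)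
  by rewrite [RHS]big_nat_rev.
rewrite nneseries_interchange; last first.
  by move=> i n; case: ifP => // _; rewrite mule_ge0.
apply: eq_eseriesr => j _.
rewrite expe2 {2}/tail measure_pred_sum.
rewrite muleC -[X in X * limn _]fineK; last exact: fin_num_measure.
rewrite -nneseriesZl => [|n _]; last by case: ifP.
apply: eq_eseriesr => n _; case: ifP => _; last by rewrite mule0.
by rewrite muleC fineK// fin_num_measure.
Qed.

(** X - Y and X are multiples of d, so neither separates the integers of a block
    [j d, (j + 1) d).  Exchanging r and s gives equality. *)
Lemma crossing_block (j r s : nat) :
    (r < supp_gcd mu)%N -> (s < supp_gcd mu)%N ->
  crossing (j * supp_gcd mu + r) <= crossing (j * supp_gcd mu + s).
Proof.
set d := supp_gcd mu => rd sd; apply: lee_nneseries => [k _ _|k _].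
  by rewrite mule_ge0.
case: (pselect (supp mu k)) => [sk|/not_supp ->]; last by rewrite !mule0.
apply: lee_wpmul2r => //; apply: le_measure_supp => n /supp_gcd_dvd + /=.
move/supp_gcd_dvd: sk; rewrite -/d => /dvdnP[b ->] /dvdnP[a ->].
have e c q : (q < d)%N -> (c * d + q < a * d)%N = (c < a)%N.
  move=> qd; apply/idP/idP => h.
    by rewrite -(ltn_pmul2r (leq_ltn_trans (leq0n _) qd)); lia.
  by have : (c.+1 * d <= a * d)%N; [rewrite leq_mul2r h orbT|lia].
have e' q : (a * d <= j * d + q + b * d)%N = ~~ ((j + b) * d + q < a * d)%N.
  by rewrite -leqNgt; congr (_ <= _)%N; lia.
by rewrite !e' !e.
Qed.

Lemma crossing_eq0 i : (forall n, supp mu n -> (n <= i)%N) -> crossing i = 0.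
Proof.
move=> h; apply: eseries0 => k _ _.
suff -> : mu [set n | (i < n <= i + k)%N] = 0 by rewrite mul0e.
by apply: measure_supp_eq0 => n /h /= ni; rewrite ltnNge ni.
Qed.

Lemma tail_dist_fun j : 1 - dist_fun mu j%:R = tail j.
Proof.
rewrite /dist_fun /massR -probability_setC//; congr (mu _).
by apply/seteqP; split=> n /=; rewrite in_itv/= ler0n ler_nat/= ltnNge => /negP.
Qed.

Lemma atom_nat n : atom mu n%:R = mu [set n].
Proof.
congr (mu _); apply/seteqP; split=> m /=; last by move=> ->.
by move/eqP; rewrite eqr_nat => /eqP.
Qed.

(** * Values of rho *)

Lemma crossing_ge1 i :
  crossing i = \sum_(1 <= k <oo) mu [set n | (i < n <= i + k)%N] * mu [set k].
Proof.
rewrite /crossing nneseries_recl// => [|k _]; last by rewrite mule_ge0.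
rewrite (_ : [set n | _] = set0) ?measure0 ?mul0e ?add0e//.
by apply/seteqP; split=> n //=; lia.
Qed.

Lemma atom_not_nat (x : R) : (forall n : nat, n%:R != x) -> atom mu x = 0.
Proof.
move=> nx; rewrite /atom /massR (_ : [set n | _] = set0) ?measure0//.
by apply/seteqP; split=> n //= /eqP; rewrite (negbTE (nx n)).
Qed.

(** For i < x < i + 1 the atoms at x and x + k carry no mass, and a natural
    number n satisfies x < n < x + k if and only if i < n <= i + k. *)
Lemma rho_between (i : nat) (x : R) : (i%:R < x < i.+1%:R)%R ->
  rho mu x = crossing i.
Proof.
move=> /andP[ix xi].
have x0 : (0 < x)%R by rewrite (le_lt_trans _ ix).
have nat_lt n : (x < n%:R)%R = (i < n)%N.
  apply/idP/idP => [xn|]; first by rewrite -(ltr_nat R) (lt_trans ix).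
  by rewrite -(ler_nat R) => /(lt_le_trans xi).
have nat_gt n k : (n%:R < x + k%:R :> R)%R = (n <= i + k)%N.
  apply/idP/idP => [nx|].
    rewrite -ltnS -(ltr_nat R) -addSn natrD (lt_le_trans nx)//.
    by rewrite lerD2r ltW.
  by rewrite -(ler_nat R) natrD => /le_lt_trans; apply; rewrite ltrD2r.
have nat_neq n k : (n%:R != x + k%:R :> R)%R.
  apply/negP => /eqP e.
  have := nat_gt n k; rewrite e ltxx => /esym/negbT; rewrite -ltnNge => h.
  have := nat_lt (n - k)%N.
  rewrite natrB ?e ?addrK ?ltxx; last first.
    by rewrite (leq_trans _ (ltnW h))// leq_addl.
  by lia.
rewrite crossing_ge1 /rho gt_eqF//; apply: eq_eseriesr => k _.
rewrite [atom mu x]atom_not_nat; last first.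
  by move=> n; have := nat_neq n 0%N; rewrite addr0.
rewrite atom_not_nat; last by move=> n; exact: nat_neq.
rewrite !mul0e adde0 add0e atom_nat; congr (mu _ * _).
by apply/seteqP; split=> n /=; rewrite in_itv/= nat_lt nat_gt.
Qed.

(** With x = i + 1 and b = mu (x, x + k), the terms of c(i) and c(i + 1) for
    Y = k are mu(x) + b and b + mu(x + k); their mean is the term of rho(x). *)
Lemma rho_nat (i : nat) :
  rho mu i.+1%:R = (crossing i + crossing i.+1) * (2^-1)%:E.
Proof.
have cr0 j k : 0 <= mu [set n | (j < n <= j + k)%N] * mu [set k].
  by rewrite mule_ge0.
rewrite !crossing_ge1 -nneseriesD// muleC -nneseriesZl => [|k _]; last first.
  by rewrite adde_ge0.
rewrite /rho pnatr_eq0/= [LHS]eseries_cond [RHS]eseries_cond.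
apply: eq_eseriesr => k /= k1.
rewrite -natrD !atom_nat -ge0_muleDl//.
rewrite muleA; congr (_ * _).
set b := massR _ _.
have bE : b = mu [set n | (i.+1 < n < i.+1 + k)%N].
  by congr (mu _); apply/seteqP; split=> n /=; rewrite in_itv/= !ltr_nat.
have -> : mu [set n | (i < n <= i + k)%N] = mu [set i.+1] + b.
  rewrite bE -measureU//; last by apply/seteqP; split=> n //= [nE]; lia.
  congr (mu _); apply/seteqP; split=> n /=; last by case=> [->|]; lia.
  by case: (eqVneq n i.+1) => [->|ni h]; [left|right; lia].
have -> : mu [set n | (i.+1 < n <= i.+1 + k)%N] = b + mu [set (i.+1 + k)%N].
  rewrite bE -measureU//; last by apply/seteqP; split=> n //= [h nE]; lia.
  congr (mu _); apply/seteqP; split=> n /=; last by case=> [|->]; lia.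
  by case: (eqVneq n (i.+1 + k)%N) => [->|ni h]; [right|left; lia].
have fb : b \is a fin_num by rewrite bE fin_num_measure.
rewrite -(fineK fb) -(fineK (fin_num_measure mu [set i.+1] _))//.
rewrite -(fineK (fin_num_measure mu [set (i.+1 + k)%N] _))//.
by rewrite -!EFinM -!EFinD; congr (_%:E); field.
Qed.

Lemma rho0 : rho mu 0 = tail 0 * (2^-1)%:E.
Proof.
rewrite /rho eqxx (_ : atom mu 0%R = mu [set 0%N]); last exact: (atom_nat 0).
rewrite -probability_setC//; congr (mu _ * _).
by apply/seteqP; split=> n /=; rewrite lt0n => /eqP.
Qed.

Lemma rho_ge0 (x : R) : 0 <= rho mu x.
Proof.
rewrite /rho; case: ifPn => [/eqP x0|_].
  rewrite mule_ge0 ?lee_fin ?invr_ge0// sube_ge0 ?probability_le1//.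
  by rewrite fin_num_measure.
apply: nneseries_ge0 => k _ _; rewrite mule_ge0//.
by rewrite !adde_ge0// mule_ge0// lee_fin invr_ge0.
Qed.

(** P(X - Y <= 0 < X) <= P(Y > 0): the event 0 < X <= Y forces Y > 0. *)
Lemma crossing0_le : crossing 0 <= tail 0.
Proof.
rewrite /crossing /tail measure_pred_sum; apply: lee_nneseries => [k _ _|k _].
  by rewrite mule_ge0.
case: ifPn => [_|]; last first.
  rewrite -eqn0Ngt => /eqP ->; rewrite (_ : [set n | _] = set0).
    by rewrite measure0 mul0e.
  by apply/seteqP; split=> n //=; lia.
by rewrite -[leRHS]mul1e lee_wpmul2r// probability_le1.
Qed.

Lemma crossing_le_rho (i : nat) (x : R) : (i%:R <= x < i.+1%:R)%R ->
  crossing i <= rho mu x + rho mu x.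
Proof.
have half (a : \bar R) : 0 <= a -> a * (2^-1)%:E + a * (2^-1)%:E = a.
  move=> a0; rewrite -ge0_muleDr ?lee_fin ?invr_ge0// -EFinD.
  by rewrite (_ : 2^-1 + 2^-1 = 1)%R ?mule1//; field.
move=> /andP[]; rewrite le_eqVlt => /predU1P[<- _|ix xi]; last first.
  by rewrite (@rho_between i) ?ix// leeDl// crossing_ge0.
case: i => [|i]; first by rewrite rho0 half ?crossing0_le.
by rewrite rho_nat half ?adde_ge0 ?leeDr// crossing_ge0.
Qed.

(** The second summand is c(i - 1), which contributes to rho(x) when x = i; its
    value 1 for i = 0 bounds rho(0). *)
Lemma rho_le_crossing (i : nat) (x : R) : (i%:R <= x < i.+1%:R)%R ->
  rho mu x <= crossing i + (if i is j.+1 then crossing j else 1).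
Proof.
have half (a : \bar R) : 0 <= a -> a * (2^-1)%:E <= a.
  move=> a0; rewrite -[leRHS]mule1 lee_wpmul2l// lee_fin.
  by rewrite invf_le1// ler1n.
have c0 := crossing_ge0.
move=> /andP[]; rewrite le_eqVlt => /predU1P[<- _|ix xi]; last first.
  by rewrite (@rho_between i) ?ix// leeDl//; case: {ix xi} i.
case: i => [|i]; last by rewrite rho_nat addeC half// adde_ge0.
rewrite rho0 (le_trans (half _ _))// (@le_trans _ _ 1) ?probability_le1//.
by rewrite leeDr.
Qed.

End NatMeasure.

(** * Total mass on the reachable states *)

Section TotalMass.
Context {R : realType} (mu : probability nat R).

Lemma esum_rho_translate (t : R) : 0 <= t < 1 ->
  (\esum_(x in range (fun i : nat => t + i%:R)%R) rho mu x <=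
   \sum_(0 <= i <oo) crossing mu i + (1 + \sum_(0 <= i <oo) crossing mu i))%E.
Proof.
move=> /andP[t0 t1]; have c0 := crossing_ge0 mu.
rewrite esum_image; last by move=> i j _ _ /addrI/eqP; rewrite eqr_nat => /eqP.
rewrite -nneseries_esumT; last by move=> i; exact: rho_ge0.
pose c' i := (if i is j.+1 then crossing mu j else 1)%E.
have c'0 i : (0 <= c' i)%E by case: i.
apply: (@le_trans _ _ (\sum_(0 <= i <oo) (crossing mu i + c' i))%E).
  apply: lee_nneseries => [i _ _|i _]; first exact: rho_ge0.
  by apply: rho_le_crossing; rewrite lerDr t0/= -natr1 addrC ltrD2l.
rewrite nneseriesD// leeD2l// nneseries_recl// leeD2l//.
by rewrite -nneseries_addn//; under eq_eseriesr do rewrite addn1.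
Qed.

Lemma nonneg_translate (y x : R) (m : int) : 0 <= x -> x = m%:~R + y ->
  exists i : nat, x = (y - (Num.floor y)%:~R) + i%:R.
Proof.
move=> x0 xE; have : 0 <= m + Num.floor y.
  move: x0; rewrite -floor_ge0 xE addrC floorDrz ?intr_int//.
  by rewrite intrKfloor addrC.
case E : (m + _) => [i|//] _; exists i.
by rewrite xE -[i%:R]/((Posz i)%:~R) -E intrD; ring.
Qed.

Lemma fractional_itv (y : R) : 0 <= y - (Num.floor y)%:~R < 1.
Proof. by rewrite subr_ge0 floor_le/= ltrBlDl -intrD1 floorD1_gt. Qed.

(** As d is an integer, x0 + d Z and - x0 + d Z are contained in the classes of
    x0 and - x0 modulo 1, whose nonnegative parts start at the fractional parts
    of x0 and - x0. *)
Lemma states_S_sub (x0 : R) : states_S mu x0 `<=`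
  range (fun i : nat => x0 - (Num.floor x0)%:~R + i%:R) `|`
  range (fun i : nat => - x0 - (Num.floor (- x0))%:~R + i%:R).
Proof.
move=> x /= [x_ge0 [k kE]].
have {}kE : x = (k * supp_gcd mu)%:~R + x0 \/ x = (k * supp_gcd mu)%:~R - x0.
  by rewrite intrM.
by case: kE => /(nonneg_translate x_ge0)[i ->]; [left|right]; exists i.
Qed.

Lemma finite_total_mass_of_crossing (x0 : R) :
  (\sum_(0 <= i <oo) crossing mu i < +oo)%E -> finite_total_mass mu x0.
Proof.
move=> fin; rewrite /finite_total_mass /rho_measure setIid.
have rho_nneg := rho_ge0 mu.
apply: le_lt_trans (esum_subset _ rho_nneg) _.
  by apply: subset_trans (@states_S_sub x0) => x [].
apply: le_lt_trans (esum_setU_le _ _ rho_nneg) _.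
have bound t : 0 <= t < 1 ->
    (\esum_(x in range (fun i : nat => t + i%:R)%R) rho mu x < +oo)%E.
  move=> /esum_rho_translate/le_lt_trans; apply.
  by rewrite !lte_add_pinfty// ltry.
by apply: lte_add_pinfty; apply/bound/fractional_itv.
Qed.

(** c(i) > 0 requires a point n > i of the support, hence n >= i + 1 > x. *)
Lemma crossing_beyond (i : nat) (x : R) :
  i%:R <= x < i.+1%:R -> ~ (x%:E <= max_supp mu)%E -> crossing mu i = 0%E.
Proof.
move=> /andP[ix xi] xN; apply: crossing_eq0 => n sn; rewrite leqNgt; apply/negP.
rewrite -(ler_nat R) => h; apply: xN.
apply: (@le_trans _ _ (n%:R : R)%:E).
  by rewrite lee_fin (le_trans (ltW xi)).
by apply: ereal_sup_ubound; exists n.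
Qed.

(** The progression is e(j) = t + j d, where t is the remainder of x0 modulo d,
    and s is the integral part of t, so that e(j) lies between j d + s and
    j d + s + 1. *)
Lemma sum_crossing_progression (x0 : R) : ~ point_mass mu -> 0 <= x0 ->
  exists2 s, (s < supp_gcd mu)%N &
    (\sum_(0 <= j <oo) crossing mu (j * supp_gcd mu + s) <=
     \esum_(x in states_C mu x0) rho mu x +
     \esum_(x in states_C mu x0) rho mu x)%E.
Proof.
move=> nd x0_ge0; set d := supp_gcd mu; have d0 : (0 < d)%N := supp_gcd_gt0 nd.
have d0R : 0 < d%:R :> R by rewrite ltr0n.
pose q := Num.truncn (x0 / d%:R).
pose t := x0 - q%:R * d%:R.
have /andP[t0 td] : 0 <= t < d%:R.
  have /truncn_itv : 0 <= x0 / d%:R by rewrite divr_ge0// ltW.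
  rewrite -/q ler_pdivlMr// ltr_pdivrMr// => /andP[ql qr].
  by rewrite /t subr_ge0 ql/= ltrBlDl -[X in _ + X]mul1r -mulrDl natr1.
pose s := Num.truncn t.
have /andP[st ts] : s%:R <= t < s.+1%:R by exact: truncn_itv.
have sd : (s < d)%N by rewrite -(ltr_nat R) (le_lt_trans st).
exists s => //.
pose e (j : nat) : R := t + j%:R * d%:R.
have e_itv j : (j * d + s)%:R <= e j < (j * d + s).+1%:R.
  rewrite /e -addnS !natrD natrM [t + _]addrC lerD2l st/=.
  by rewrite ltrD2l.
have eS j : states_S mu x0 (e j).
  split; first by rewrite addr_ge0// mulr_ge0.
  exists (Posz j - Posz q); left; rewrite /e /t intrB -/d; ring.
have rho_nneg := rho_ge0 mu; have c0 := crossing_ge0 mu.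
pose J := [set j | ((e j)%:E <= max_supp mu)%E].
rewrite -esumD; [|by move=> *; exact: rho_nneg..].
apply: (@le_trans _ _ (\esum_(x in e @` J) (rho mu x + rho mu x))%E).
  rewrite esum_image; last first.
    move=> i j _ _ /addrI/(mulIf (lt0r_neq0 d0R))/eqP.
    by rewrite eqr_nat => /eqP.
  rewrite esum_mkcond nneseries_esumT//; apply: le_esum => j _.
  case: ifPn => [_|jJ]; first exact: crossing_le_rho.
  rewrite (crossing_beyond (e_itv j))// => jN.
  by move: jJ; rewrite notin_setE.
apply: esum_subset => [_ [j Jj <-]|x]; first by split.
by rewrite adde_ge0.
Qed.

Lemma crossing_of_finite_total_mass (x0 : R) : ~ point_mass mu -> 0 <= x0 ->
  finite_total_mass mu x0 -> (\sum_(0 <= i <oo) crossing mu i < +oo)%E.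
Proof.
move=> nd x0_ge0; rewrite /finite_total_mass /rho_measure setIid => fin.
have [s sd le] := sum_crossing_progression nd x0_ge0.
have c0 := crossing_ge0 mu.
apply: le_lt_trans (nneseries_le_residues (supp_gcd_gt0 nd) c0) _.
rewrite big_mkord; apply: lte_sum_pinfty => r _.
apply: le_lt_trans (lte_add_pinfty fin fin); apply: le_trans le.
by apply: lee_nneseries => // j _; exact: crossing_block.
Qed.

End TotalMass.

Theorem mainTheorem2 (R : realType) (mu : probability nat R)
    (mu_not_point_mass : ~ point_mass mu) :
  ((exists x0 : R, 0 <= x0 /\ finite_total_mass mu x0) <->
     (\sum_(0 <= k <oo) (1 - dist_fun mu k%:R) ^+ 2 < +oo)%E) /\
  ((forall x0 : R, 0 <= x0 -> finite_total_mass mu x0) <->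
     (\sum_(0 <= k <oo) (1 - dist_fun mu k%:R) ^+ 2 < +oo)%E).
Proof.
under eq_eseriesr do rewrite tail_dist_fun.
rewrite -sum_crossing.
have fwd x0 := @crossing_of_finite_total_mass R mu x0 mu_not_point_mass.
have bwd x0 := @finite_total_mass_of_crossing R mu x0.
split; split.
- by move=> [x0 [x0_ge0]]; exact: fwd.
- by exists 0; split; [|exact: bwd].
- by move/(_ 0 (lexx 0)); exact: fwd.
- by move=> fin x0 _; exact: bwd.
Qed.
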